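(* Let $\theta$ be a permutation of $\{1,\dots,m\}\times\{1,\dots,n\}$ for which there are indices $i_0\in\{1,\dots,m\}$ and $j_0\in\{1,\dots,n\}$ such that there is no solution $(i,j)$ to $e_{i_0}f_j=f_{j_0}e_i$ in $\mathbb{F}_\theta^+$. Let $\pi$ be defined on $\mathbb{C}^2$ with orthonormal basis $\{\xi_1,\xi_2\}$ by $$\pi(e_{i_0})=\pi(f_{j_0})=\xi_2\xi_1^*,\qquad \pi(e_i)=0\ (i\neq i_0),\quad \pi(f_j)=0\ (j\ne j_0),$$ where $\xi_2\xi_1^*$ is the operator $\eta\mapsto\langle\eta,\xi_1\rangle\xi_2$. Then $\pi$ determines a row contractive representation of $\mathbb{F}_\theta^+$ which does not extend to a contractive representation of $\mathcal{A}_\theta$.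
   Context: $\mathbb{F}_\theta^+$ is the unital semigroup generated by $e_1,\dots,e_m,f_1,\dots,f_n$ subject only to the relations $e_if_j=f_{j'}e_{i'}$ whenever $\theta(i,j)=(i',j')$. The left regular representation is $\lambda(w)\xi_x=\xi_{wx}$ on $\ell^2(\mathbb{F}_\theta^+)$, and $\mathcal{A}_\theta$ is the norm closed unital operator algebra generated by $\lambda(\mathbb{F}_\theta^+)$. A representation $\sigma$ of $\mathbb{F}_\theta^+$ is a (unital) semigroup homomorphism into $B(\mathcal{H})$. It is row contractive if the row operators $[\sigma(e_1)\cdots\sigma(e_m)]$ and $[\sigma(f_1)\cdots\sigma(f_n)]$ are contractions. It is contractive if it extends to a contractive representation of $\mathcal{A}_\theta$ (with $\lambda(w)\mapsto\sigma(w)$). *)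

(* Defs.v *)
From HB Require Import structures.
From mathcomp Require Import all_boot all_order all_algebra all_fingroup.
From mathcomp Require Import generic_quotient complex.
From mathcomp Require Import ring lra.
From mathcomp Require Import all_classical all_reals ereal esum.

Set Implicit Arguments.
Unset Strict Implicit.
Unset Printing Implicit Defensive.

Import Order.TTheory GRing.Theory Num.Theory.

Local Open Scope quotient_scope.
Local Open Scope classical_set_scope.
Local Open Scope ring_scope.

Notation normc := ComplexField.Normc.normc.

(** [inl i] stands for the letter [e_i] and [inr j] for [f_j]. *)
Notation word m n := (seq ('I_m + 'I_n)).

Section Semigroup.
Variables (m n : nat) (theta : {perm 'I_m * 'I_n}).

(** The least congruence on words identifying [e_i f_j] with [f_j' e_i']
    whenever [theta (i, j) = (i', j')]. *)
Inductive word_cong : word m n -> word m n -> Prop :=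
| cong_comm i j : word_cong [:: inl i; inr j]
                            [:: inr (theta (i, j)).2; inl (theta (i, j)).1]
| cong_refl u : word_cong u u
| cong_sym u v : word_cong u v -> word_cong v u
| cong_trans u v w : word_cong u v -> word_cong v w -> word_cong u w
| cong_cat u u' v v' :
    word_cong u u' -> word_cong v v' -> word_cong (u ++ v) (u' ++ v').

Definition word_congb : rel (word m n) := fun u v => `[< word_cong u v >].

Lemma word_congb_refl : reflexive word_congb.
Proof. by move=> u; apply/asboolP/cong_refl. Qed.

Lemma word_congb_sym : symmetric word_congb.
Proof. by move=> u v; apply/asboolP/asboolP => /cong_sym. Qed.

Lemma word_congb_trans : transitive word_congb.
Proof.
by move=> v u w /asboolP uv /asboolP vw; apply/asboolP/(cong_trans uv vw).
Qed.

Canonical word_congb_equiv :=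
  EquivRel word_congb word_congb_refl word_congb_sym word_congb_trans.

Definition Ftheta : Type := {eq_quot word_congb}.

HB.instance Definition _ := Choice.on Ftheta.
HB.instance Definition _ := Quotient.on Ftheta.
HB.instance Definition _ := EqQuotient.on Ftheta.

Definition Fword (u : word m n) : Ftheta := (\pi_Ftheta u)%qT.
Definition Fe (i : 'I_m) : Ftheta := Fword [:: inl i].
Definition Ff (j : 'I_n) : Ftheta := Fword [:: inr j].

Lemma FwordP u v : Fword u = Fword v <-> word_cong u v.
Proof.
split=> [/eqmodP/asboolP //|uv].
by apply/eqmodP/asboolP.
Qed.

Lemma reprFwordK x : Fword (repr x) = x. Proof. exact: reprK. Qed.

Definition Fmul (x y : Ftheta) : Ftheta := Fword (repr x ++ repr y).

Lemma Fmul_word u v : Fmul (Fword u) (Fword v) = Fword (u ++ v).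
Proof. by apply/FwordP/cong_cat; apply/FwordP; rewrite reprFwordK. Qed.

Lemma FmulA : associative Fmul.
Proof.
move=> x y z; rewrite -[x]reprFwordK -[y]reprFwordK -[z]reprFwordK.
by rewrite !Fmul_word catA.
Qed.

Lemma Fmul1x : left_id (Fword [::]) Fmul.
Proof. by move=> x; rewrite -[x]reprFwordK Fmul_word. Qed.

Lemma Fmulx1 : right_id (Fword [::]) Fmul.
Proof. by move=> x; rewrite -[x]reprFwordK Fmul_word cats0. Qed.

HB.instance Definition _ := isMonoid.Build Ftheta FmulA Fmul1x Fmulx1.

Lemma Fword_cat u v : Fword (u ++ v) = (Fword u * Fword v)%g.
Proof. by rewrite -Fmul_word. Qed.

Lemma Fe_Ff i j :
  (Fe i * Ff j = Ff (theta (i, j)).2 * Fe (theta (i, j)).1)%g.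
Proof. by rewrite -!Fword_cat; apply/FwordP; exact: cong_comm. Qed.

(** Every element is uniquely of the form [e_(i1) .. e_(ik) f_(j1) .. f_(jl)];
    [nf] computes it, [f_j] being pushed through the [e]'s by [theta^-1]. *)
Definition normal_form : Type := (seq 'I_m * seq 'I_n)%type.

Fixpoint pushf (j : 'I_n) (u : seq 'I_m) : seq 'I_m * 'I_n :=
  if u is i :: u' then
    let p := (theta^-1)%g (i, j) in
    let q := pushf p.2 u' in (p.1 :: q.1, q.2)
  else ([::], j).

Definition act (a : 'I_m + 'I_n) (p : normal_form) : normal_form :=
  match a with
  | inl i => (i :: p.1, p.2)
  | inr j => ((pushf j p.1).1, (pushf j p.1).2 :: p.2)
  end.

Definition act_word (w : word m n) (p : normal_form) : normal_form :=
  foldr act p w.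

Lemma act_word_cong u v : word_cong u v -> act_word u =1 act_word v.
Proof.
elim=> {u v} [i j p|//|u v _ IH p|u v w _ IHu _ IHv p|u u' v v' _ IHu _ IHv p].
- by rewrite /= -surjective_pairing permK.
- by rewrite IH.
- by rewrite IHu.
- by rewrite /act_word !foldr_cat -!/(act_word _ _) IHu IHv.
Qed.

Lemma pushf_inj j k u v : pushf j u = pushf k v -> j = k /\ u = v.
Proof.
elim: u v j k => [|i u IH] [|i' v] j k //= [] //.
move=> e1 e2 e3.
have [e4 ->] : ((theta^-1)%g (i, j)).2 = ((theta^-1)%g (i', k)).2 /\ u = v.
  apply: IH.
  by rewrite [LHS]surjective_pairing [RHS]surjective_pairing e2 e3.
have /perm_inj[-> ->] // : (theta^-1)%g (i, j) = (theta^-1)%g (i', k).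
by rewrite [LHS]surjective_pairing [RHS]surjective_pairing e1 e4.
Qed.

Lemma act_inj a : injective (act a).
Proof.
case: a => [i|j] [u v] [u' v'] /= [].
  by move=> -> ->.
move=> e1 e2 ->; have [_ ->] // : j = j /\ u = u'.
apply: pushf_inj.
by rewrite [LHS]surjective_pairing [RHS]surjective_pairing e1 e2.
Qed.

Lemma act_word_inj w : injective (act_word w).
Proof. by elim: w => [|a w IH] //= p q /act_inj/IH. Qed.

Definition nf_word (p : normal_form) : word m n := map inl p.1 ++ map inr p.2.

Lemma pushf_cong j u : word_cong (inr j :: map inl u)
  (map inl (pushf j u).1 ++ [:: inr (pushf j u).2]).
Proof.
elim: u j => [|i u IH] j /=; first exact: cong_refl.
set p := (theta^-1)%g (i, j).
have ep : theta (p.1, p.2) = (i, j) by rewrite -surjective_pairing permKV.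
have := cong_comm p.1 p.2; rewrite ep /= => /cong_sym h1.
apply: (cong_trans (cong_cat h1 (cong_refl (map inl u)))).
exact: (cong_cat (cong_refl [:: inl p.1]) (IH p.2)).
Qed.

Lemma act_cong a p : word_cong (a :: nf_word p) (nf_word (act a p)).
Proof.
case: a p => [i|j] [u v] /=; first exact: cong_refl.
rewrite /nf_word /= -cat1s catA.
apply: (cong_trans (cong_cat (pushf_cong j u) (cong_refl (map inr v)))).
by rewrite -catA; exact: cong_refl.
Qed.

Lemma act_word_nf w : word_cong w (nf_word (act_word w ([::], [::]))).
Proof.
elim: w => [|a w IH]; first exact: cong_refl.
exact: cong_trans (cong_cat (cong_refl [:: a]) IH) (act_cong _ _).
Qed.

Definition nf (x : Ftheta) : normal_form := act_word (repr x) ([::], [::]).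

Lemma nf_Fword w : nf (Fword w) = act_word w ([::], [::]).
Proof. by apply: act_word_cong; apply/FwordP; exact: reprFwordK. Qed.

Lemma nf_inj : injective nf.
Proof.
move=> x y exy; rewrite -[x]reprFwordK -[y]reprFwordK; apply/FwordP.
apply: (cong_trans (act_word_nf _)); rewrite -/(nf x) exy.
exact/cong_sym/act_word_nf.
Qed.

Lemma nf_mul u y : nf (Fword u * y)%g = act_word u (nf y).
Proof.
rewrite -[y in LHS]reprFwordK -Fword_cat nf_Fword /act_word foldr_cat //.
Qed.

Lemma mulFI (w : Ftheta) : injective (fun x : Ftheta => (w * x)%g).
Proof.
move=> x y /= /(congr1 nf); rewrite -[w]reprFwordK !nf_mul.
by move=> /act_word_inj/nf_inj.
Qed.

End Semigroup.

(** [nrm] is the norm of [V]; it is a separate argument because the norm of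
    [C^d] must be the Euclidean one, not the sup norm of matrices. *)

Section Operators.
Variables (R : realType) (V : lmodType R[i]) (nrm : V -> R).

Definition bounded_operator (T : V -> V) : Prop :=
  linear T /\ exists M : R, forall v, nrm (T v) <= M * nrm v.

Definition opnorm (T : V -> V) : R :=
  sup [set nrm (T v) | v in [set v | nrm v <= 1]].

Definition norm_closed_unital_algebra (A : set (V -> V)) : Prop :=
  [/\ A `<=` bounded_operator,
      A id,
      (forall S T, A S -> A T -> A (S + T)),
      (forall (c : R[i]) T, A T -> A (c *: T)) &
      (forall S T, A S -> A T -> A (S \o T))] /\
  (forall T, bounded_operator T ->
     (forall eps : R, 0 < eps -> exists2 S, A S & opnorm (T - S) < eps) -> A T).

(** The row operator [[T_1 ... T_k] : V^k -> V] is a contraction, where [V^k]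
    carries the l^2-direct-sum norm. *)
Definition row_contraction (k : nat) (T : 'I_k -> V -> V) : Prop :=
  forall v : 'I_k -> V, nrm (\sum_i T i (v i)) ^+ 2 <= \sum_i nrm (v i) ^+ 2.

End Operators.

Section Ell2.
Variables (R : realType) (X : choiceType).
Local Notation C := R[i].

Definition sqsum (x : X -> C) : \bar R :=
  \esum_(t in [set: X]) ((normc (x t) ^+ 2)%:E).

Definition square_summable : {pred X -> C} :=
  fun x => `[< (sqsum x < +oo)%E >].

Lemma normcZ2 (c z : C) : normc (c * z) ^+ 2 = normc c ^+ 2 * normc z ^+ 2.
Proof. by rewrite ComplexField.Normc.normcM exprMn. Qed.

Lemma normc2E (z : C) : normc z ^+ 2 = complex.Re z ^+ 2 + complex.Im z ^+ 2.
Proof. by case: z => a b /=; rewrite sqr_sqrtr // addr_ge0 ?sqr_ge0. Qed.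

Lemma normcD2 (a b : C) :
  normc (a + b) ^+ 2 <= 2 * normc a ^+ 2 + 2 * normc b ^+ 2.
Proof.
rewrite !normc2E; case: a => a a'; case: b => b b' /=.
rewrite -subr_ge0 (_ : _ - _ = (a - b) ^+ 2 + (a' - b') ^+ 2); last by ring.
by rewrite addr_ge0 ?sqr_ge0.
Qed.

Lemma esumZl (c : R) (a : X -> R) : 0 <= c -> (forall t, 0 <= a t) ->
  (\esum_(t in [set: X]) (a t)%:E < +oo)%E ->
  (\esum_(t in [set: X]) (c * a t)%:E < +oo)%E.
Proof.
move=> c0 a0; set S := (X in (X < _)%E) => Sfin.
have S0 : (0 <= S)%E by apply: esum_ge0 => t _; rewrite lee_fin.
apply: (@le_lt_trans _ _ (c%:E * S)%E); last first.
  by rewrite lte_mul_pinfty.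
apply: ge_ereal_sup => _ [F [finF _] <-].
rewrite (_ : (\sum_(t \in F) (c * a t)%:E = c%:E * \sum_(t \in F) (a t)%:E)%E).
  by rewrite lee_wpmul2l // esum_ge //; exists F.
by rewrite ge0_mule_fsumr // => t; rewrite lee_fin.
Qed.

Lemma square_summable_submod : submod_closed square_summable.
Proof.
split=> [|c x y /asboolP xfin /asboolP yfin]; apply/asboolP.
  rewrite /sqsum esum1 ?ltry // => t _.
  by rewrite ComplexField.Normc.normc0 expr0n.
apply: (@le_lt_trans _ _ (\esum_(t in [set: X])
   ((2 * normc c ^+ 2 * normc (x t) ^+ 2)%:E + (2 * normc (y t) ^+ 2)%:E))%E).
  apply: le_esum => t _; rewrite -EFinD lee_fin.
  by rewrite (le_trans (normcD2 _ _)) // normcZ2 mulrA.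
rewrite esumD.
- apply: lte_add_pinfty; apply: esumZl => //.
  + by rewrite mulr_ge0 ?sqr_ge0.
  + by move=> t; rewrite sqr_ge0.
  + by move=> t; rewrite sqr_ge0.
- move=> t _; rewrite lee_fin -mulrA mulr_ge0 ?sqr_ge0 //.
  by rewrite -exprMn sqr_ge0.
- by move=> t _; rewrite lee_fin mulr_ge0 ?sqr_ge0.
Qed.

HB.instance Definition _ := GRing.isSubmodClosed.Build C (X -> C)
  square_summable square_summable_submod.

Record ell2 := Ell2 { ell2_fun :> X -> C; _ : ell2_fun \in square_summable }.

HB.instance Definition _ := [isSub for ell2_fun].
HB.instance Definition _ := [Choice of ell2 by <:].
HB.instance Definition _ := [SubChoice_isSubLmodule of ell2 by <:].

Definition ell2_norm (x : ell2) : R := Num.sqrt (fine (sqsum x)).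

Definition delta_fun (t : X) : X -> C := fun s => (s == t)%:R.

Lemma sqsum_delta t : sqsum (delta_fun t) = 1%E.
Proof.
rewrite /sqsum -(@esum_set1 R X t (fun=> 1%E)) // [RHS]esum_mkcond.
apply: eq_esum => s _; rewrite /delta_fun; case: eqP => [->|st].
  by rewrite mem_set // ComplexField.Normc.normc1 expr1n.
by rewrite memNset // ComplexField.Normc.normc0 expr0n.
Qed.

Lemma delta_proof t : delta_fun t \in square_summable.
Proof. by apply/asboolP; rewrite sqsum_delta ltry. Qed.

Definition delta (t : X) : ell2 := Ell2 (delta_proof t).

End Ell2.

Section LeftRegular.
Variables (R : realType) (m n : nat) (theta : {perm 'I_m * 'I_n}).
Local Notation C := R[i].
Local Notation F := (Ftheta theta).
Local Notation H := (ell2 R F).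

(** [(lambda w x) t = x s] if [t = w s], and [0] if [t] is not in [w F]; such an
    [s] is unique by [mulFI], and [lambda_delta] is the usual formula. *)
Definition lambda_fun (w : F) (x : F -> C) : F -> C := fun t =>
  if pselect (exists s, (w * s)%g = t) is left ex then x (projT1 (cid ex))
  else 0.

Lemma sqsum_lambda w x : (sqsum (lambda_fun w x) <= sqsum x)%E.
Proof.
pose D := [set t | exists s, (w * s)%g = t].
pose g t : F := if pselect (exists s, (w * s)%g = t) is left ex
  then projT1 (cid ex) else 1%g.
have gK t : D t -> (w * g t)%g = t.
  by rewrite /g; case: pselect => // ex _; case: cid.
rewrite [leLHS](_ : _ = \esum_(t in D) ((normc (x (g t)) ^+ 2)%:E)); last first.
  rewrite [RHS]esum_mkcond; apply: eq_esum => t _; rewrite /lambda_fun /g.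
  case: pselect => [ex|nex]; first by rewrite mem_set.
  by rewrite memNset // ComplexField.Normc.normc0 expr0n.
have ginj : set_inj D g.
  by move=> s t /set_mem Ds /set_mem Dt est; rewrite -(gK s) // est gK.
rewrite -(@esum_image R F F D g (fun s => (normc (x s) ^+ 2)%:E) ginj).
rewrite esum_mkcond.
apply: le_esum => t _; case: ifP => // _.
by rewrite lee_fin sqr_ge0.
Qed.

Lemma lambda_proof w (x : H) : lambda_fun w x \in @square_summable R F.
Proof.
apply/asboolP; apply: le_lt_trans (sqsum_lambda w x) _.
by case: x => x /= /asboolP.
Qed.

Definition lambda (w : F) (x : H) : H := Ell2 (lambda_proof w x).

Lemma ell2P (x y : H) : (forall t, x t = y t) -> x = y.
Proof. by move=> e; apply/val_inj/funext. Qed.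

Lemma lambdaE w (x : H) s : lambda w x (w * s)%g = x s.
Proof.
rewrite /= /lambda_fun; case: pselect => [ex|[]]; last by exists s.
by case: cid => s' /= /mulFI ->.
Qed.

Lemma lambda_out w (x : H) t :
  (forall s, (w * s)%g <> t) -> lambda w x t = 0.
Proof.
move=> nt; rewrite /= /lambda_fun; case: pselect => // ex.
by case: {-}(ex) => s /nt.
Qed.

Lemma lambda_delta w s : lambda w (delta R s) = delta R (w * s)%g.
Proof.
apply: ell2P => t; have [[r <-]|nt] := pselect (exists r, (w * r)%g = t).
  by rewrite lambdaE /= /delta_fun (inj_eq (@mulFI _ _ theta w)).
rewrite lambda_out; last by move=> r er; apply: nt; exists r.
by rewrite /= /delta_fun; case: eqP => // et; case: nt; exists s.
Qed.

Definition Atheta : set (H -> H) :=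
  smallest (norm_closed_unital_algebra (@ell2_norm R F)) (range lambda).

End LeftRegular.

(** [H] stands for a Hilbert space with norm [nrm]; only the vector space
    structure and the norm enter these definitions. *)

Section Representations.
Variables (R : realType) (m n : nat) (theta : {perm 'I_m * 'I_n}).
Local Notation C := R[i].
Local Notation F := (Ftheta theta).
Local Notation L := (ell2 R F).
Variables (H : lmodType C) (nrm : H -> R).

Definition is_representation (sigma : F -> H -> H) : Prop :=
  [/\ forall w, bounded_operator nrm (sigma w),
      sigma 1%g = id &
      forall v w, sigma (v * w)%g = sigma v \o sigma w].

Definition row_contractive (sigma : F -> H -> H) : Prop :=
  row_contraction nrm (fun i => sigma (Fe theta i)) /\
  row_contraction nrm (fun j => sigma (Ff theta j)).

(** [rho] is meaningful on [A_theta] only; its values elsewhere are junk. *)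
Definition contractive_Atheta_representation
    (rho : (L -> L) -> H -> H) : Prop :=
  let A := @Atheta R m n theta in
  [/\ (forall T, A T -> bounded_operator nrm (rho T)) /\ rho id = id,
      (forall S T, A S -> A T -> rho (S + T) = rho S + rho T),
      (forall (c : C) T, A T -> rho (c *: T) = c *: rho T),
      (forall S T, A S -> A T -> rho (S \o T) = rho S \o rho T) &
      (forall T, A T -> opnorm nrm (rho T) <= opnorm (@ell2_norm R F) T)].

Definition contractive_representation (sigma : F -> H -> H) : Prop :=
  exists2 rho, contractive_Atheta_representation rho &
    forall w, rho (lambda w) = sigma w.

End Representations.

Section Euclidean.
Variables (R : realType) (d : nat).
Local Notation C := R[i].

Definition dotC (u v : 'cV[C]_d) : C := \sum_k u k 0 * ((v k 0)^*)%C.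

Definition normC2 (v : 'cV[C]_d) : R := Num.sqrt (complex.Re (dotC v v)).

(** The operator [u v^*]. *)
Definition rank_one (u v : 'cV[C]_d) : 'cV[C]_d -> 'cV[C]_d :=
  fun eta => dotC eta v *: u.

End Euclidean.

(** Two orthonormal vectors of [C^2] form a basis, by dimension. *)
Definition orthonormal_basis2 (R : realType) (xi1 xi2 : 'cV[R[i]]_2) : Prop :=
  [/\ dotC xi1 xi1 = 1, dotC xi2 xi2 = 1 & dotC xi1 xi2 = 0].

(* Main.v *)
Require Import Defs.
From HB Require Import structures.
From mathcomp Require Import all_boot all_order all_algebra all_fingroup.
From mathcomp Require Import generic_quotient complex.
From mathcomp Require Import all_classical all_reals ereal esum.
From mathcomp Require Import ring lra.

Set Implicit Arguments.
Unset Strict Implicit.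
Unset Printing Implicit Defensive.

Import Order.TTheory GRing.Theory Num.Theory.

Local Open Scope classical_set_scope.
Local Open Scope ring_scope.

(** Write [N] for the operator [xi2 xi1^*]. Since [xi1] and [xi2] are orthogonal,
    [N \o N = 0], so any two generators are sent to operators with product [0].
    The commutation relations of the semigroup equate products of two
    generators, hence hold trivially, and [pi] exists ([rep_of_Fword]). Each of
    the two rows has a single nonzero entry [N], a contraction by Bessel's
    inequality, so [pi] is row contractive ([row_contraction_single]).

    The obstruction is the norm of [T = lambda e_i0 + lambda f_j0]. An equality
    [e_i0 x = f_j0 y] would, on comparing the first letters of the normal forms,
    solve [e_i0 f_j = f_j0 e_i] ([disjoint_ranges]). So the two isometries have
    orthogonal ranges and [T] has norm at most [sqrt 2] ([opnorm_lambdaD]). An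
    extension of [pi] sends [T] to [2 N], of norm at least [2]
    ([opnorm_rank_one_double]), and therefore is not contractive. *)

(** * Rank-one operators on Euclidean space *)

Section EuclideanNorm.
Variables (R : realType) (d : nat).
Local Notation C := R[i].
Implicit Types u v w : 'cV[C]_d.

Lemma dotCDl u v w : dotC (u + v) w = dotC u w + dotC v w.
Proof.
by rewrite /dotC -big_split; apply: eq_bigr => k _; rewrite mxE mulrDl.
Qed.

Lemma dotCZl (c : C) u w : dotC (c *: u) w = c * dotC u w.
Proof.
by rewrite /dotC mulr_sumr; apply: eq_bigr => k _; rewrite mxE mulrA.
Qed.

Lemma dotC_conj u v : ((dotC u v)^*)%C = dotC v u.
Proof.
rewrite /dotC rmorph_sum; apply: eq_bigr => k _.
by rewrite rmorphM /= conjcK mulrC.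
Qed.

Lemma dotCDr u v w : dotC w (u + v) = dotC w u + dotC w v.
Proof. by rewrite -dotC_conj dotCDl rmorphD /= !dotC_conj. Qed.

Lemma dotCZr (c : C) u w : dotC w (c *: u) = (c^*)%C * dotC w u.
Proof. by rewrite -dotC_conj dotCZl rmorphM /= dotC_conj. Qed.

Lemma Re_mul_conj (z : C) : complex.Re (z * (z^*)%C) = normc z ^+ 2.
Proof. by rewrite normc2E; case: z => a b /=; ring. Qed.

Lemma Re_dotC_ge0 v : 0 <= complex.Re (dotC v v).
Proof.
rewrite /dotC raddf_sum; apply: sumr_ge0 => k _.
by rewrite /= Re_mul_conj sqr_ge0.
Qed.

Lemma normC2_ge0 v : 0 <= normC2 v.
Proof. exact: sqrtr_ge0. Qed.

Lemma sqr_normC2 v : normC2 v ^+ 2 = complex.Re (dotC v v).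
Proof. by rewrite sqr_sqrtr // Re_dotC_ge0. Qed.

Lemma normC2_0 : normC2 (0 : 'cV[C]_d) = 0.
Proof.
rewrite /normC2 /dotC big1 ?sqrtr0 // => k _.
by rewrite mxE mul0r.
Qed.

Lemma sqr_normC2Z (c : C) u : normC2 (c *: u) ^+ 2 = normc c ^+ 2 * normC2 u ^+ 2.
Proof.
rewrite !sqr_normC2 /dotC !raddf_sum mulr_sumr; apply: eq_bigr => k _.
by rewrite /= mxE !Re_mul_conj normcZ2.
Qed.

(** The right side minus the left side is the squared norm of the component
    [v - (dotC v u) u] of [v] orthogonal to [u]. *)
Lemma bessel_unit u v : dotC u u = 1 -> normc (dotC v u) ^+ 2 <= normC2 v ^+ 2.
Proof.
move=> uu; pose c := dotC v u.
have := Re_dotC_ge0 (- c *: u + v).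
suff -> : dotC (- c *: u + v) (- c *: u + v) = dotC v v - c * (c^*)%C.
  by rewrite raddfB /= Re_mul_conj sqr_normC2 subr_ge0.
rewrite !(dotCDl, dotCDr, dotCZl, dotCZr) uu -(dotC_conj v u) -/c rmorphN /=.
by ring.
Qed.

Lemma linear_rank_one u v : linear (rank_one u v).
Proof.
by move=> a x y; rewrite /rank_one dotCDl dotCZl scalerDl scalerA.
Qed.

Lemma normC2_rank_one u v x : dotC u u = 1 -> dotC v v = 1 ->
  normC2 (rank_one u v x) <= normC2 x.
Proof.
move=> uu vv; rewrite -(ler_pXn2r (n := 2)) ?nnegrE ?normC2_ge0 //.
by rewrite sqr_normC2Z [normC2 u ^+ 2]sqr_normC2 uu /= mulr1 bessel_unit.
Qed.

Lemma rank_one_orthogonal u v x :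
  dotC u v = 0 -> rank_one u v (rank_one u v x) = 0.
Proof.
move=> uv; by rewrite /rank_one dotCZl uv mulr0 scale0r. Qed.

Lemma row_contraction_single k (i0 : 'I_k) (T : 'I_k -> 'cV[C]_d -> 'cV[C]_d) :
  (forall i, i != i0 -> T i = 0) ->
  (forall x, normC2 (T i0 x) <= normC2 x) -> row_contraction (@normC2 R d) T.
Proof.
move=> T0 Ti0 v; rewrite (bigD1 i0) //= big1 => [|i /T0 -> //]; rewrite addr0.
rewrite (bigD1 i0) //= -[leLHS]addr0 lerD ?sumr_ge0 // => [|i _].
  by rewrite ler_pXn2r ?nnegrE ?normC2_ge0.
exact: sqr_ge0.
Qed.

End EuclideanNorm.

(** * Representations of the semigroup given by their generators *)

Section WordEvaluation.
Variables (m n : nat) (theta : {perm 'I_m * 'I_n}).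
Variables (V : Type) (op : 'I_m + 'I_n -> V -> V).

Definition eval_word (w : word m n) : V -> V := foldr (fun a f => op a \o f) id w.

Lemma eval_word_cat u v : eval_word (u ++ v) = eval_word u \o eval_word v.
Proof. by elim: u => [//|a u /= ->]. Qed.

Hypothesis op_comm : forall i j, op (inl i) \o op (inr j) =
  op (inr (theta (i, j)).2) \o op (inl (theta (i, j)).1).

Lemma eval_word_cong u v : word_cong theta u v -> eval_word u = eval_word v.
Proof.
elim=> {u v} [i j|//|//|u v w _ -> _ -> //|u u' v v' _ IHu _ IHv].
  exact: op_comm.
by rewrite !eval_word_cat IHu IHv.
Qed.

Definition rep_of (x : Ftheta theta) : V -> V := eval_word (repr x).

Lemma rep_of_Fword w : rep_of (Fword theta w) = eval_word w.
Proof. by apply: eval_word_cong; apply/FwordP; rewrite reprFwordK. Qed.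

Lemma rep_of1 : rep_of 1%g = id.
Proof. exact: (rep_of_Fword [::]). Qed.

Lemma rep_ofM x y : rep_of (x * y)%g = rep_of x \o rep_of y.
Proof.
by rewrite -[x]reprFwordK -[y]reprFwordK -Fword_cat !rep_of_Fword eval_word_cat.
Qed.

Lemma rep_of_unique (sigma : Ftheta theta -> V -> V) :
  sigma 1%g = id -> (forall x y, sigma (x * y)%g = sigma x \o sigma y) ->
  (forall a, sigma (Fword theta [:: a]) = op a) -> sigma = rep_of.
Proof.
move=> s1 sM sop; apply/funext => x; rewrite -[x]reprFwordK rep_of_Fword.
elim: (repr x) => [//|a w IH].
by rewrite -cat1s Fword_cat sM sop IH.
Qed.

End WordEvaluation.

(** * The norm of the sum of two isometries with orthogonal ranges *)

Section OrthogonalRanges.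
Variables (R : realType) (m n : nat) (theta : {perm 'I_m * 'I_n}).
Local Notation F := (Ftheta theta).
Local Notation H := (ell2 R F).

(** The normal form of [e_i0 x] begins with [e_i0]. That of [f_j0 y] has no [e]
    at all if [y] has none; otherwise, if [y] begins with [e_i], it begins with
    the [e_i'] for which [f_j0 e_i = e_i' f_j], so that [i' = i0] gives a
    solution [(i, j)]. *)
Lemma disjoint_ranges (i0 : 'I_m) (j0 : 'I_n) :
  ~ (exists (i : 'I_m) (j : 'I_n),
       (Fe theta i0 * Ff theta j)%g = (Ff theta j0 * Fe theta i)%g) ->
  forall x y, (Fe theta i0 * x)%g <> (Ff theta j0 * y)%g.
Proof.
move=> nosol x y /(congr1 (@nf _ _ theta)); rewrite !nf_mul /=.
case: (nf y) => -[|i u] v //= [ei _ _]; apply: nosol.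
pose p := (theta^-1)%g (i, j0); exists i, p.2.
by rewrite ei Fe_Ff -surjective_pairing permKV.
Qed.

(** At each point of the semigroup at most one of the two summands is nonzero,
    so there is no cross term. *)
Lemma sqsum_lambdaD (v w : F) (x : H) :
  (forall s t, (v * s)%g <> (w * t)%g) ->
  (sqsum (lambda v x + lambda w x : H)%R <= sqsum x + sqsum x)%E.
Proof.
move=> vw.
apply: le_trans (leeD (sqsum_lambda v x) (sqsum_lambda w x)).
rewrite -esumD; try by move=> t _; rewrite lee_fin sqr_ge0.
apply: le_esum => t _; rewrite -EFinD lee_fin.
have -> : (lambda v x + lambda w x : H) t = lambda v x t + lambda w x t by [].
rewrite -[lambda_fun v _ t]/(lambda v x t) -[lambda_fun w _ t]/(lambda w x t).
have [[s ts]|nt] := pselect (exists s, (v * s)%g = t).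
  rewrite [lambda w x t]lambda_out => [|r]; last by rewrite -ts => /esym/vw.
  by rewrite addr0 lerDl sqr_ge0.
rewrite [lambda v x t]lambda_out => [|r rt]; last by apply: nt; exists r.
by rewrite add0r lerDr sqr_ge0.
Qed.

Lemma ell2_norm_lambdaD (v w : F) (x : H) :
  (forall s t, (v * s)%g <> (w * t)%g) -> ell2_norm x <= 1 ->
  ell2_norm (lambda v x + lambda w x) <= Num.sqrt 2.
Proof.
move=> vw; rewrite /ell2_norm -{1}sqrtr1 ler_sqrt // => x1.
have sq0 (y : H) : (0 <= sqsum y)%E.
  by apply: esum_ge0 => t _; rewrite lee_fin sqr_ge0.
have sqfin (y : H) : sqsum y \is a fin_num.
  by rewrite ge0_fin_numE //; case: y => y /= /asboolP.
rewrite ler_sqrt //.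
apply: (@le_trans _ _ (fine (sqsum x + sqsum x))).
  by rewrite fine_le ?fin_numD ?sqfin // sqsum_lambdaD.
by rewrite fineD // (_ : 2 = 1 + 1) // lerD.
Qed.

Lemma Atheta_lambda w : @Atheta R m n theta (@lambda R m n theta w).
Proof. by apply: sub_gen_smallest; exists w. Qed.

Lemma opnorm_lambdaD (v w : F) : (forall s t, (v * s)%g <> (w * t)%g) ->
  opnorm (@ell2_norm R F) (@lambda R m n theta v + lambda w) <= Num.sqrt 2.
Proof.
move=> vw; apply: ge_sup.
  exists (ell2_norm ((@lambda R m n theta v + lambda w) 0)); exists 0 => //=.
  rewrite /ell2_norm /sqsum esum1 ?sqrtr0 ?ler01 // => t _.
  by rewrite ComplexField.Normc.normc0 expr0n.
by move=> _ [x /= x1 <-]; exact: ell2_norm_lambdaD.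
Qed.

End OrthogonalRanges.

(** * A row contractive representation that is not contractive *)

(** The value [2] is attained at the unit vector [v]. As [opnorm] is a
    supremum of reals, the lower bound also needs the set of values to be bounded
    above, which is the contractivity of [rank_one u v]. *)
Lemma opnorm_rank_one_double (R : realType) (d : nat) (u v : 'cV[R[i]]_d) :
  dotC u u = 1 -> dotC v v = 1 ->
  2 <= opnorm (@normC2 R d) (rank_one u v + rank_one u v).
Proof.
move=> uu vv.
have normD x : normC2 ((rank_one u v + rank_one u v) x) = 2 * normC2 (rank_one u v x).
  have -> : (rank_one u v + rank_one u v) x = 2 *: rank_one u v x.
    by rewrite scaler_nat mulr2n.
  apply/eqP; rewrite -(eqrXn2 (n := 2)) ?mulr_ge0 ?normC2_ge0 //.
  rewrite sqr_normC2Z exprMn; apply/eqP; congr (_ * _).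
  by rewrite normc2E /=; ring.
have v1 : normC2 v = 1 by rewrite /normC2 vv sqrtr1.
apply: sup_upper_bound.
  split; first by exists (normC2 ((rank_one u v + rank_one u v) v)), v; rewrite /= ?v1.
  exists 2 => _ [x /= x1 <-]; rewrite normD -[leRHS]mulr1 ler_pM2l //.
  by rewrite (le_trans (normC2_rank_one _ _ _)).
exists v; rewrite /= ?v1 // normD /rank_one vv scale1r.
by rewrite /normC2 uu sqrtr1 mulr1.
Qed.

Theorem mainTheorem5 (R : realType) (m n : nat) (theta : {perm 'I_m * 'I_n})
    (i0 : 'I_m) (j0 : 'I_n)
    (no_solution : ~ exists (i : 'I_m) (j : 'I_n),
       (Fe theta i0 * Ff theta j)%g = (Ff theta j0 * Fe theta i)%g)
    (xi1 xi2 : 'cV[R[i]]_2) (xi_onb : orthonormal_basis2 xi1 xi2) :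
  let generator_values (pi : Ftheta theta -> 'cV[R[i]]_2 -> 'cV[R[i]]_2) :=
    [/\ pi (Fe theta i0) = rank_one xi2 xi1,
        pi (Ff theta j0) = rank_one xi2 xi1,
        (forall i, i != i0 -> pi (Fe theta i) = 0) &
        (forall j, j != j0 -> pi (Ff theta j) = 0)] in
  exists pi : Ftheta theta -> 'cV[R[i]]_2 -> 'cV[R[i]]_2,
    [/\ is_representation (@normC2 R 2) pi,
        generator_values pi,
        (forall pi', is_representation (@normC2 R 2) pi' ->
           generator_values pi' -> pi' = pi),
        row_contractive (@normC2 R 2) pi &
        ~ contractive_representation (@normC2 R 2) pi].
Proof.
case: xi_onb => n1 n2 o12 generator_values.
have o21 : dotC xi2 xi1 = 0 by rewrite -dotC_conj o12 conjc0.
pose N := rank_one xi2 xi1.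
pose op (a : 'I_m + 'I_n) : 'cV[R[i]]_2 -> 'cV[R[i]]_2 :=
  if (a == inl i0) || (a == inr j0) then N else 0.
have N_lin : linear N by exact: linear_rank_one.
have N0 : N 0 = 0.
  by have := N_lin (-1) 0 0; rewrite !scaleN1r !addNr.
have NN x : N (N x) = 0 by exact: rank_one_orthogonal.
(* All products of two generators vanish, so the relations become 0 = 0. *)
have op_op a b : op a \o op b = 0.
  apply/funext => x; rewrite /= /op.
  by case: ifP => // _; case: ifP => // _; rewrite ?NN ?N0.
have op_comm i j : op (inl i) \o op (inr j) =
    op (inr (theta (i, j)).2) \o op (inl (theta (i, j)).1).
  by rewrite !op_op.
have op_contr a x : normC2 (op a x) <= normC2 x.
  rewrite /op; case: ifP => _; first exact: normC2_rank_one.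
  by rewrite /= normC2_0 normC2_ge0.
have op_lin a : linear (op a).
  move=> c x y; rewrite /op; case: ifP => _; first exact: N_lin.
  by change (0 = c *: 0 + 0 :> 'cV[R[i]]_2); rewrite scaler0 addr0.
have eval_bounded w : bounded_operator (@normC2 R 2) (eval_word op w).
  suff [lin contr] : linear (eval_word op w) /\
      forall x, normC2 (eval_word op w x) <= normC2 x.
    by split=> //; exists 1 => x; rewrite mul1r.
  elim: w => [//|a w [IHl IHc]]; split=> [c x y|x] /=.
    by rewrite IHl op_lin.
  exact: le_trans (op_contr _ _) (IHc x).
have rep_op a : rep_of op (Fword theta [:: a]) = op a.
  exact: rep_of_Fword.
have vals : generator_values (rep_of (theta := theta) op).
  split=> [||i ii0|j jj0]; rewrite [LHS]rep_op /op ?eqxx ?orbT //.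
    by rewrite orbF (inj_eq (@inl_inj _ _)) (negPf ii0).
  by rewrite /= (inj_eq (@inr_inj _ _)) (negPf jj0).
exists (rep_of (theta := theta) op); case: (vals) => ve vf ve0 vf0; split=> //.
- by split=> [w||]; [exact: eval_bounded | exact: rep_of1 | exact: rep_ofM].
- move=> pi' [_ pi1 piM] [pe pf pe0 pf0]; apply: rep_of_unique => // -[i|j].
    rewrite /op orbF (inj_eq (@inl_inj _ _)).
    by have [->|/pe0 //] := eqVneq i i0.
  rewrite /op /= (inj_eq (@inr_inj _ _)).
  by have [->|/pf0 //] := eqVneq j j0.
- split; [apply: (@row_contraction_single _ _ _ i0) => // x; rewrite ve
         |apply: (@row_contraction_single _ _ _ j0) => // x; rewrite vf];
    exact: normC2_rank_one.
case=> rho [_ rhoD _ _ rho_contr] rho_lambda.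
have orth := disjoint_ranges no_solution.
(* The extension would have to send T, of norm at most sqrt 2, to 2 N. *)
pose T := @lambda R m n theta (Fe theta i0) + lambda (Ff theta j0).
have AT : Atheta T.
  move=> A [Aalg Agen]; case: (Aalg) => -[_ _ AD _ _] _.
  by apply: AD; apply: Agen; [exists (Fe theta i0) | exists (Ff theta j0)].
have := rho_contr T AT.
rewrite rhoD ?rho_lambda; [|exact: Atheta_lambda..].
rewrite ve vf => le_rho.
have := le_trans (opnorm_rank_one_double n2 n1) (le_trans le_rho (opnorm_lambdaD R orth)).
rewrite -(ler_pXn2r (n := 2)) ?nnegrE ?sqrtr_ge0 // sqr_sqrtr //.
by lra.
Qed.
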